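(* If a Borel function $\pi$ from an analytic metric space $X$ to a separable metric space is not $\sigma$-continuous with closed witnesses, then $\mathfrak{d}$ is the least cardinal $\kappa$ for which $X$ is the union of $\kappa$-many closed sets on which $\pi$ is continuous.
   Context: Working in $\mathsf{ZFC}$. A topological space is analytic if it is a continuous image of a closed subset of $\mathbb{N}^{\mathbb{N}}$. A function is Borel if preimages of open sets are Borel. $\pi$ is $\sigma$-continuous with closed witnesses if its domain is the union of countably many closed sets on each of which $\pi$ is continuous; ''$\pi$ is continuous on $F$'' means that the restriction of $\pi$ to $F$ is continuous. $\mathfrak{d}$ is the dominating number: the least cardinality of a set $\mathcal{F}\subseteq\mathbb{N}^{\mathbb{N}}$ such that for every $c\in\mathbb{N}^{\mathbb{N}}$ there is $d\in\mathcal{F}$ with $c(n)\le d(n)$ for all but finitely many $n$. *)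

(* Defs.v *)
From HB Require Import structures.
From mathcomp Require Import all_boot all_order all_algebra.
From mathcomp Require Import all_classical all_reals all_analysis.

Set Implicit Arguments.
Unset Strict Implicit.
Unset Printing Implicit Defensive.

Local Open Scope classical_set_scope.
Local Open Scope card_scope.

(* [nat] carries the discrete topology. *)
Definition baire_space : Type := prod_topology (fun _ : nat => nat).

HB.instance Definition _ := Pointed.on baire_space.
HB.instance Definition _ := Nbhs.on baire_space.
HB.instance Definition _ := Topological.on baire_space.

(* The domain of [f] is the subtype [C] with its induced topology, rather than
   the whole Baire space, so that the empty space is analytic ([C = set0]). *)
Definition analytic_space (X : topologicalType) : Prop :=
  exists (C : set baire_space) (f : C -> X),
    [/\ closed C, continuous f & range f = [set: X]].

Definition separable_space (X : topologicalType) : Prop :=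
  exists2 S : set X, countable S & dense S.

Definition borel_function (X Y : topologicalType) (pi : X -> Y) : Prop :=
  forall U : set Y, open U -> <<s @open X >> (pi @^-1` U).

(* A cardinal is represented by any set [K], in any type, having that
   cardinality; cardinals are compared with [#<=]. *)
Definition closed_continuity_cover (X Y : topologicalType) (pi : X -> Y)
    (T : Type) (K : set T) : Prop :=
  exists F : T -> set X,
    (forall i, K i -> closed (F i) /\ {within F i, continuous pi}) /\
    \bigcup_(i in K) F i = [set: X].

Definition sigma_continuous_closed (X Y : topologicalType) (pi : X -> Y) : Prop :=
  closed_continuity_cover pi [set: nat].

Definition least_cardinal (P : forall T : Type, set T -> Prop)
    (T : Type) (K : set T) : Prop :=
  P T K /\ forall (U : Type) (L : set U), P U L -> K #<= L.

Definition dominating (D : set (nat -> nat)) : Prop :=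
  forall c : nat -> nat,
    exists2 d, D d & \forall n \near \oo, (c n <= d n)%N.

(* Cardinals are well-ordered: apply Zorn's lemma to the families of choice
   functions on [P] no two of which agree anywhere. *)
Lemma exists_least_card (T : pointedType) (P : set (set T)) :
  P !=set0 -> exists2 D, P D & forall D', P D' -> D #<= D'.
Proof.
move=> [D0 PD0].
pose Q (S : set (set T -> T)) :=
  (forall f D, S f -> P D -> D (f D)) /\
  (forall f g D, S f -> S g -> P D -> f D = g D -> f = g).
have [S [[Smem Sinj] Smax]] : exists S, Q S /\ forall B, S `<` B -> ~ Q B.
  apply: Zorn_bigcup => F FQ Ftot; split.
    by move=> f D [S FS Sf] PD; have [H _] := FQ _ FS; exact: (H f D).
  move=> f g D [S FS Sf] [S' FS' S'g] PD.
  have [SS'|S'S] := Ftot _ _ FS FS'.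
  - by have [_ H] := FQ _ FS'; apply: (H f g D) => //; exact: SS'.
  - by have [_ H] := FQ _ FS; apply: (H f g D) => //; exact: S'S.
have [[D PD Dsurj]|noD] :=
    pselect (exists2 D, P D & forall x, D x -> exists2 f, S f & f D = x).
  exists D => // D' PD'.
  pose h x := xget (fun=> point) [set f | S f /\ f D = x].
  have hP x : D x -> S (h x) /\ h x D = x.
    move=> Dx; rewrite /h; case: xgetP => [f _ //|] H.
    by have [f Sf fD] := Dsurj _ Dx; case: (H f).
  apply/pcard_leP/injfunPex; exists (fun x => h x D').
    by move=> x /hP[Sh _]; exact: (Smem (h x) D').
  move=> x y /set_mem/hP[Sx hx] /set_mem/hP[Sy hy] e.
  by rewrite -hx -hy (Sinj _ _ _ Sx Sy PD' e).
have ex D : P D -> exists x, D x /\ forall f, S f -> f D <> x.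
  move=> PD; apply: contrapT => H; apply: noD; exists D => // x Dx.
  apply: contrapT => H'; apply: H; exists x; split=> // f Sf fx.
  by apply: H'; exists f.
pose k D := xget point [set x | D x /\ forall f, S f -> f D <> x].
have kP D : P D -> D (k D) /\ forall f, S f -> f D <> k D.
  move=> PD; rewrite /k; case: xgetP => [x _ //|] H.
  by have [x Hx] := ex _ PD; case: (H x).
exfalso; apply: (Smax (S `|` [set k])).
  split; first by move=> f Sf; left.
  by move=> /(_ k (or_intror erefl)) /(proj2 (kP _ PD0)); apply.
split; first by move=> f D [Sf|->] PD; [exact: (Smem f D)|exact: (kP D PD).1].
move=> f g D [Sf|->] [Sg|->] PD e //; first exact: (Sinj f g D).
- by case: (proj2 (kP _ PD) _ Sf).
- by case: (proj2 (kP _ PD) _ Sg).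
Qed.

Lemma exists_least_dominating :
  exists D, dominating D /\ forall D', dominating D' -> D #<= D'.
Proof.
have [|D] := @exists_least_card (nat -> nat) dominating; last by exists D.
by exists setT => c; exists c => //; exact: nearW.
Qed.

(* A dominating set of least cardinality, standing for the cardinal d. *)
Definition dominating_number : set (nat -> nat) :=
  sval (cid exists_least_dominating).

Lemma dominating_numberP : dominating dominating_number /\
  forall D, dominating D -> dominating_number #<= D.
Proof. exact: svalP (cid exists_least_dominating). Qed.

(* Main.v *)
Require Import Defs.
From mathcomp Require Import all_boot all_order all_algebra.
From mathcomp Require Import all_classical all_reals all_analysis.

Set Implicit Arguments.
Unset Strict Implicit.
Unset Printing Implicit Defensive.

Import Order.TTheory GRing.Theory Num.Theory.

Local Open Scope classical_set_scope.
Local Open Scope card_scope.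

(** Refining the parametrization of [X] makes both [f : C -> X] and [pi \o f]
    continuous on a closed subset [C] of the Baire space. For the upper bound,
    the Baire space is a union of d-many compact boxes, and [pi] is continuous
    on the image of a compact set on which [f] and [pi \o f] are continuous.

    For the lower bound, remove from [C] the relatively open pieces whose
    images are sigma-small. In the kernel [K] that is left, [pi] is
    discontinuous on the closure of the image of every nonempty relatively open
    [U], so there are a point [y] and points [z_k] of [U] with [f z_k --> y]
    but [pi (f z_k)] away from [pi y]. Shrinking [U] around the [z_k] and
    iterating gives a tree of open sets, hence a map [psi] from the Baire space
    to [X]. A closed set on which [pi] is continuous can meet only finitely many
    children of each node, since otherwise it would contain [y] and [pi] would
    be discontinuous there. So its preimage under [psi] is bounded, and a closed
    cover yields a dominating family. *)

(** * Neighbourhoods and cylinders in the Baire space *)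

Lemma closed_nearP (T : topologicalType) (A : set T) :
  closed A <-> forall z, ~ A z -> \forall w \near z, ~ A w.
Proof.
split=> [/closed_openC + z nAz|H]; first by rewrite openE => /(_ z nAz).
by rewrite -[A]setCK; apply: open_closedC; rewrite openE => z; exact: H.
Qed.

Lemma within_continuous_nearP (S T : topologicalType) (A : set S) (f : S -> T) :
  {within A, continuous f} <->
  forall z, A z -> forall U, nbhs (f z) U -> \forall w \near z, A w -> U (f w).
Proof. exact: subspace_continuousP. Qed.

Definition cylinder (z : baire_space) (n : nat) : set baire_space :=
  [set w | forall i, (i < n)%N -> w i = z i].

Lemma cylinder_eq z w n : cylinder z n w -> cylinder w n = cylinder z n.
Proof. by move=> zw; apply/seteqP; split=> v H i ilen; rewrite H// zw. Qed.

Lemma nbhs_baireP (z : baire_space) (A : set baire_space) :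
  nbhs z A <-> exists n : nat, cylinder z n `<=` A.
Proof.
pose F := filter_from setT (cylinder z).
have FF : Filter F.
  apply: filter_from_filter; first by exists 0%N.
  move=> i j _ _; exists (maxn i j) => // w zw; split=> k ki; apply: zw;
    by rewrite leq_max ki ?orbT.
split=> [zA|[n H]].
  (* A filter converges in the product topology as soon as it converges in every coordinate, and
     [cylinder z i.+1] already fixes coordinate [i]. *)
  suff /(_ A zA)[n _ H] : F --> z by exists n.
  apply/(@cvg_sup _ _ _ F z FF) => i U [V [[W] oW <-] Wzi WU].
  apply: (@filterS _ F FF _ _ WU); exists i.+1 => // w zw /=.
  by rewrite /preimage/= zw.
suff : \forall w \near z, cylinder z n w by apply: filterS => w; exact: H.
elim: n {H} => [|n IH]; first exact: (@nearW _ (nbhs z)).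
have zn : \forall w \near z, (w : baire_space) n = z n.
  have : nbhs (z n) [set z n] by apply/principal_filterP.
  exact: (@proj_continuous nat (fun=> nat) n z).
near=> w => i; rewrite ltnS leq_eqVlt => /orP[/eqP->|].
  by near: w.
by move: i; near: w.
Unshelve. all: by end_near. Qed.

Lemma nbhs_cylinder (z : baire_space) n :
  \forall w \near z, forall i, (i < n)%N -> (w : baire_space) i = z i.
Proof. by apply/nbhs_baireP; exists n => w. Qed.

Lemma continuous_baire_reindex (h : nat -> nat) :
  continuous ((fun z => z \o h) : baire_space -> baire_space).
Proof.
move=> z A /nbhs_baireP[n H]; apply/nbhs_baireP.
exists (\max_(i < n) (h i).+1)%N => w zw; apply: H => i ilen /=; apply: zw.
exact: (@leq_bigmax _ (fun i : 'I_n => (h i).+1) (Ordinal ilen)).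
Qed.

(** * Parametrizations by closed subsets of the Baire space *)

Definition parametrizes (X : topologicalType) (C : set baire_space)
    (f : baire_space -> X) : Prop :=
  [/\ closed C, {within C, continuous f} & forall x, exists2 z, C z & f z = x].

Lemma analytic_parametrizes (X : topologicalType) (x0 : X) :
  analytic_space X -> exists C f, @parametrizes X C f.
Proof.
(* [x0] only serves as the value of the extended map off [C]. *)
move=> [C [f [cC cf fT]]]; exists C, (valL_ x0 f); split=> //.
  exact/subspace_valL_continuousP'.
move=> x; have [z _ <-] : range f x by rewrite fT.
exists (val z); first exact: set_valP.
by rewrite -[in RHS](valLK x0 f).
Qed.

Lemma within_continuous_precomp (S T U : topologicalType) (A : set S)
    (B : set T) (h : S -> T) (f : T -> U) :
  continuous h -> (forall x, A x -> B (h x)) ->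
  {within B, continuous f} -> {within A, continuous (f \o h)}.
Proof.
move=> ch AB /within_continuous_nearP cf; apply/within_continuous_nearP.
move=> x Ax V fV; have := ch x _ (cf _ (AB _ Ax) V fV).
by apply: (@filterS _ (nbhs x)) => y H Ay; apply: H; exact: AB.
Qed.

Definition baire_tail (w : baire_space) : baire_space := w \o S.

(** A new first coordinate records which of countably many closed pieces, possibly overlapping, the
    point is taken from. That coordinate is locally constant, so the pieces become disjoint and
    relatively clopen. *)
Lemma parametrizes_tag (X : topologicalType) C f (A : nat -> set baire_space) :
  @parametrizes X C f -> (forall m, closed (C `&` A m)) ->
  (forall x, exists m z, [/\ C z, A m z & f z = x]) ->
  @parametrizes X [set w | C (baire_tail w) /\ A (w 0) (baire_tail w)]
    (f \o baire_tail).
Proof.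
have ct : continuous baire_tail := @continuous_baire_reindex S.
move=> [cC cf _] cA fA; split.
- apply/closed_nearP => w nw.
  have /closed_nearP/(_ (baire_tail w) nw)/(ct w) := cA (w 0).
  by apply: filterS2 (nbhs_cylinder w 1) => v vw; rewrite /= vw.
- by apply: within_continuous_precomp cf => // w [].
- move=> x; have [m [z [Cz Az <-]]] := fA x.
  by exists (fun n => if n is k.+1 then z k else m).
Qed.

Definition pair_code (n k : nat) : nat := pickle (n, k).

Definition baire_coord (n : nat) (w : baire_space) : baire_space :=
  w \o pair_code n.

(** Common refinement of countably many parametrizations: one point of the Baire space codes a
    sequence of parameters, and requiring them all to name the same point of [X] is a closed
    condition because [X] is Hausdorff. *)
Lemma parametrizes_fiber_product (X : topologicalType)
    (C : nat -> set baire_space) (f : nat -> baire_space -> X) :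
  hausdorff_space X -> (forall n, parametrizes (C n) (f n)) ->
  parametrizes
    [set w | forall n, C n (baire_coord n w) /\
                       f n (baire_coord n w) = f 0 (baire_coord 0 w)]
    (f 0 \o baire_coord 0).
Proof.
move=> hX Cf; have cc n : continuous (baire_coord n) :=
  @continuous_baire_reindex (pair_code n).
split.
- apply/closed_nearP => w /existsNP[n nw].
  suff : \forall v \near w, ~ (C n (baire_coord n v) /\
      C 0 (baire_coord 0 v) /\ f n (baire_coord n v) = f 0 (baire_coord 0 v)).
    apply: filterS => v nv H; apply: nv.
    by have [? ?] := H n; have [? _] := H 0.
  have [[cCn /within_continuous_nearP cfn _]
        [cC0 /within_continuous_nearP cf0 _]] := (Cf n, Cf 0).
  have [Cn|nCn] := pselect (C n (baire_coord n w)); last first.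
    have /closed_nearP/(_ _ nCn)/(cc n w) := cCn.
    by apply: (@filterS _ (nbhs w)) => v nv [].
  have [C0|nC0] := pselect (C 0 (baire_coord 0 w)); last first.
    have /closed_nearP/(_ _ nC0)/(cc 0 w) := cC0.
    by apply: (@filterS _ (nbhs w)) => v nv [_ []].
  have ne : f n (baire_coord n w) != f 0 (baire_coord 0 w).
    by apply/eqP => e; apply: nw.
  have := hX; rewrite open_hausdorff => /(_ _ _ ne)[[U V]/=].
  rewrite !inE => -[Uw Vw] [oU oV UV0].
  have /(cc n w) nU := cfn _ Cn U (open_nbhs_nbhs (conj oU Uw)).
  have /(cc 0 w) nV := cf0 _ C0 V (open_nbhs_nbhs (conj oV Vw)).
  apply: (@filterS2 _ (nbhs w) _ _ _ _ _ nU nV) => v Uv Vv [Cnv [C0v e]].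
  have : (U `&` V) (f 0 (baire_coord 0 v)).
    by split; [rewrite -e; exact: Uv|exact: Vv].
  by rewrite UV0.
- have [_ cf _] := Cf 0.
  by apply: within_continuous_precomp cf => // w /(_ 0)[].
- move=> x; have /choice[z zP] : forall n, exists z, C n z /\ f n z = x.
    by move=> n; have [_ _ /(_ x)[z Cz fz]] := Cf n; exists z.
  (* The value 0 at numbers that code no pair is never read by [baire_coord]. *)
  pose w : baire_space := fun m =>
    if (unpickle m : option (nat * nat)) is Some p then z p.1 p.2 else 0.
  have wE n : baire_coord n w = z n.
    by apply/funext => k; rewrite /baire_coord /pair_code /w /= pickleK.
  exists w; last by rewrite /= wE; case: (zP 0).
  by move=> n; rewrite !wE; have [[Cz ->] [_ ->]] := (zP n, zP 0).
Qed.

(** * Borel sets become clopen in a refined parametrization *)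

Lemma closed_baire_coord (i : nat) (P : nat -> Prop) :
  closed [set z : baire_space | P (z i)].
Proof.
apply/closed_nearP => z nPz; apply: filterS (nbhs_cylinder z i.+1) => w zw.
by rewrite /= zw.
Qed.

(* [0 < z 0] decides a subset of [C] that is clopen in [C]: refining the
   parametrization makes the preimage of [B] clopen. *)
Definition decided (X : topologicalType) (B : set X) : Prop :=
  exists C f, @parametrizes X C f /\
    forall z, C z -> (B (f z) <-> (0 < z 0)%N).

Lemma decidedC (X : topologicalType) (B : set X) : decided B -> decided (~` B).
Proof.
move=> [C [f [Cf fB]]].
(* The new first coordinate is positive exactly when the old one is zero. *)
pose A m : set baire_space := [set z | (0 < m)%N = ~~ (0 < z 0)%N].
exists [set w | C (baire_tail w) /\ A (w 0) (baire_tail w)], (f \o baire_tail).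
split.
  apply: parametrizes_tag => // [m|x].
    apply: closedI; first by have [] := Cf.
    exact: (@closed_baire_coord 0 (fun k => (0 < m)%N = ~~ (0 < k)%N)).
  have [_ _ /(_ x)[z Cz fz]] := Cf.
  by exists (~~ (0 < z 0)%N), z; split=> //; rewrite /A /=; case: (0 < z 0)%N.
move=> w [Cw Aw]; rewrite Aw /= fB //.
by split=> [/negP|/negP].
Qed.

Lemma decided_bigcup (X : topologicalType) (B : nat -> set X) :
  hausdorff_space X -> (forall n, decided (B n)) -> decided (\bigcup_n B n).
Proof.
move=> hX dB.
have /choice[c cP] : forall n, exists p : set baire_space * (baire_space -> X),
    parametrizes p.1 p.2 /\ forall z, p.1 z -> (B n (p.2 z) <-> (0 < z 0)%N).
  by move=> n; have [C [f Cf]] := dB n; exists (C, f).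
have Cf := @parametrizes_fiber_product X _ _ hX (fun n => (cP n).1).
set C := (X in parametrizes X) in Cf; set f := (X in parametrizes _ X) in Cf.
have fB n w : C w -> (B n (f w) <-> (0 < w (pair_code n 0))%N).
  move=> Cw; have [Cn e] := Cw n.
  have -> : f w = (c n).2 (baire_coord n w) := esym e.
  exact: (cP n).2.
(* Tag [k.+1] certifies membership in [B k]; tag 0 marks the complement of the union, which is
   relatively closed once every [B n] is relatively clopen. *)
pose A m : set baire_space := if m is k.+1
  then [set w | (0 < w (pair_code k 0))%N]
  else \bigcap_n [set w | w (pair_code n 0) = 0].
exists [set w | C (baire_tail w) /\ A (w 0) (baire_tail w)], (f \o baire_tail).
split.
  apply: parametrizes_tag => // [m|x].
    apply: closedI; first by have [] := Cf.
    case: m => [|k] /=; last exact: (@closed_baire_coord _ (leq 1)).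
    apply: closed_bigI => n _.
    exact: (@closed_baire_coord _ (fun k => k = 0)).
  have [_ _ /(_ x)[w Cw fw]] := Cf.
  have [[k _ Bk]|nB] := pselect ((\bigcup_n B n) x).
    by exists k.+1, w; split=> //; apply/fB => //; rewrite fw.
  exists 0, w; split=> // n _; apply/eqP; rewrite -leqn0 leqNgt; apply/negP.
  by move=> /(fB _ _ Cw); rewrite fw => Bn; apply: nB; exists n.
move=> w [Cw]; rewrite /A; case: (w 0) => [|k] Aw; split=> //.
- by move=> [n _ /(fB _ _ Cw)]; rewrite Aw.
- by move=> _; exists k => //; apply/fB.
Qed.

Lemma metric_ball_open (R : realType) (X : metricType R) (x : X) (e : R) :
  open (ball x e).
Proof.
rewrite openE => y; rewrite ballEmdist /= => xy; apply/nbhs_ballP.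
exists (e - mdist x y)%R; first by rewrite /= subr_gt0.
move=> z; rewrite !ballEmdist /= ltrBrDl; apply: le_lt_trans.
exact: metric_triangle.
Qed.

Lemma natSinv_lt_eventually (R : realType) (e : R) : (0 < e)%R ->
  exists b : nat, forall k, (b <= k)%N -> (k.+1%:R^-1 < e)%R.
Proof.
move=> e0; have [b _ H] := near_infty_natSinv_lt (PosNum e0).
by exists b => k bk; exact: (H k).
Qed.

Lemma open_Fsigma (R : realType) (X : metricType R) (U : set X) :
  open U -> exists E : nat -> set X,
    (forall n, closed (E n)) /\ U = \bigcup_n E n.
Proof.
move=> oU; exists (fun n => [set x | ball x (n.+1%:R^-1)%R `<=` U]); split.
  move=> n; apply/closed_nearP => x /= /existsNP[y /not_implyP[xy nUy]].
  have : \forall x' \near x, ball y (n.+1%:R^-1)%R x'.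
    have := metric_ball_open y (n.+1%:R^-1)%R.
    rewrite openE; apply; exact: ball_sym.
  by apply: filterS => x' /ball_sym yx' /(_ y yx').
apply/seteqP; split=> x.
  move=> Ux; have /nbhs_ballP[e /= e0 eU] : nbhs x U.
    exact: open_nbhs_nbhs.
  have [n ne] := natSinv_lt_eventually e0.
  exists n => // y /= xy; apply: eU; apply: le_ball xy.
  by apply: ltW; exact: ne.
by move=> [n _ H]; apply: H; apply: ballxx; rewrite invr_gt0.
Qed.

Lemma decided_open (R : realType) (X : metricType R) C f (U : set X) :
  @parametrizes X C f -> open U -> decided U.
Proof.
move=> Cf oU; have [E [cE UE]] := open_Fsigma oU.
(* Tagging requires closed pieces, so [U] is cut into the closed sets [E k], and tag 0 marks its
   complement. *)
pose A m := f @^-1` (if m is k.+1 then E k else ~` U).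
exists [set w | C (baire_tail w) /\ A (w 0) (baire_tail w)], (f \o baire_tail).
split.
  apply: parametrizes_tag => // [m|x].
    have cA : closed (if m is k.+1 then E k else ~` U).
      by case: m => [|k] //; exact: open_closedC.
    have [cC /within_continuous_nearP cf _] := Cf.
    apply/closed_nearP => z nz; have [Cz|nCz] := pselect (C z); last first.
      have /closed_nearP/(_ z nCz) := cC.
      by apply: (@filterS _ (nbhs z)) => w nw [].
    have nfz : ~ (if m is k.+1 then E k else ~` U) (f z).
      by move=> H; apply: nz.
    have /closed_nearP/(_ _ nfz)/(cf z Cz) := cA.
    by apply: (@filterS _ (nbhs z)) => w H [Cw]; exact: (H Cw).
  have [_ _ /(_ x)[z Cz fz]] := Cf.
  have [|nU] := pselect (U x).
    by rewrite UE => -[k _ Ek]; exists k.+1, z; split=> //; rewrite /A/= fz.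
  by exists 0, z; split=> //; rewrite /A/= fz.
move=> w [Cw]; rewrite /A; case: (w 0) => [|k] /= Aw; split=> //.
by move=> _; rewrite UE; exists k.
Qed.

(** The decided sets form a sigma-algebra containing the open sets. *)
Lemma decided_borel (R : realType) (X : metricType R) C f (B : set X) :
  @parametrizes X C f -> <<s @open X >> B -> decided B.
Proof.
move=> Cf; apply: (smallest_sub (X := @decided X)); last first.
  by move=> U; exact: decided_open Cf.
split.
- by apply: decided_open Cf _; exact: open0.
- by move=> A dA; rewrite setTD; exact: decidedC.
- by move=> A dA; apply: decided_bigcup => //; exact: metric_hausdorff.
Qed.

Lemma separable_countable_base (R : realType) (Y : metricType R) :
  separable_space Y -> exists V : nat -> set Y, (forall n, open (V n)) /\
    forall y U, nbhs y U -> exists n, V n y /\ V n `<=` U.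
Proof.
move=> [S /countable_injP[h hinj] dS].
pose B i k := [set y : Y | exists s,
  [/\ S s, h s = i & ball s (k.+1%:R^-1)%R y]].
exists (fun m => if (unpickle m : option (nat * nat)) is Some p
                 then B p.1 p.2 else set0); split.
  move=> m; case: unpickle => [[i k]|]; last exact: open0.
  rewrite openE => y [s [Ss hs sy]].
  have : nbhs y (ball s (k.+1%:R^-1)%R).
    by have := metric_ball_open s (k.+1%:R^-1)%R; rewrite openE; apply.
  by apply: filterS => z sz; exists s.
move=> y U /nbhs_ballP[e /= e0 eU].
have e20 : (0 < e / 2)%R by rewrite divr_gt0.
have [k /(_ k (leqnn k)) ke] := natSinv_lt_eventually e20.
have k0 : (0 < k.+1%:R^-1 :> R)%R by rewrite invr_gt0.
have [s [ys Ss]] : ball y (k.+1%:R^-1)%R `&` S !=set0.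
  apply: dS; last exact: metric_ball_open.
  by exists y; exact: ballxx.
exists (pair_code (h s) k); rewrite /pair_code pickleK; split.
  by exists s; split=> //; exact: ball_sym.
move=> z [s' [Ss' hs' s'z]]; apply: eU.
have ss' : s' = s by apply: hinj => //; rewrite inE.
rewrite ss' in s'z; have := ball_triangle ys s'z; apply: le_ball.
by rewrite [leRHS]splitr; apply: lerD; exact: ltW.
Qed.

(** For each basic open [V n], some parametrization decides its preimage under [pi]. In their common
    refinement a single coordinate of [w] tells whether [pi (f w)] lies in [V n], whence the
    continuity of [pi \o f]. *)
Lemma borel_parametrizes (R : realType) (X Y : metricType R) (pi : X -> Y)
    (x0 : X) :
  analytic_space X -> separable_space Y -> borel_function pi ->
  exists C f, @parametrizes X C f /\ {within C, continuous (pi \o f)}.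
Proof.
move=> /(analytic_parametrizes x0)[C0 [f0 Cf0]].
move=> /separable_countable_base[V [oV Vbase]] bpi.
have /choice[c cP] : forall n, exists p : set baire_space * (baire_space -> X),
    parametrizes p.1 p.2 /\
    forall z, p.1 z -> (V n (pi (p.2 z)) <-> (0 < z 0)%N).
  move=> n; have [C [f Cf]] := decided_borel Cf0 (bpi _ (oV n)).
  by exists (C, f).
have Cf := @parametrizes_fiber_product X _ _ (@metric_hausdorff _ _)
  (fun n => (cP n).1).
set C := (X in parametrizes X) in Cf; set f := (X in parametrizes _ X) in Cf.
have fV n w : C w -> (V n (pi (f w)) <-> (0 < w (pair_code n 0))%N).
  move=> Cw; have [Cn e] := Cw n.
  have -> : f w = (c n).2 (baire_coord n w) := esym e.
  exact: (cP n).2.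
exists C, f; split=> //; apply/within_continuous_nearP => w Cw U.
move=> /Vbase[n [Vn VU]].
apply: filterS (nbhs_cylinder w (pair_code n 0).+1) => v vw Cv.
by apply: VU; apply/(fV _ _ Cv); rewrite vw//; exact/(fV _ _ Cw).
Qed.

(** * The upper bound *)

(** On a compact set [f] is a closed map, hence a quotient map onto its image, and continuity of
    [pi \o f] descends to [pi]. *)
Lemma closed_continuity_compact_image (S X Y : topologicalType) (pi : X -> Y)
    (K : set S) (f : S -> X) :
  hausdorff_space X -> closed K -> compact K -> {within K, continuous f} ->
  {within K, continuous (pi \o f)} ->
  closed (f @` K) /\ {within f @` K, continuous pi}.
Proof.
move=> hX cK kK cf cg; split.
  by apply: compact_closed => //; exact: continuous_compact.
apply/within_continuous_nearP => _ [z Kz <-] U nU.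
(* The parameters that [pi \o f] sends outside the interior of [U]: their image is closed and misses
   [f z], so its complement is the required neighbourhood. *)
pose K' := K `&` ~` (pi \o f) @^-1` U°.
have cK' : closed (f @` K').
  apply: compact_closed => //; apply: continuous_compact.
    by apply: continuous_subspaceW cf => w [].
  apply: (subclosed_compact _ kK); last by move=> w [].
  apply/closed_nearP => w nw; have [Kw|nKw] := pselect (K w); last first.
    have /closed_nearP/(_ w nKw) := cK.
    by apply: (@filterS _ (nbhs w)) => v nv [].
  have Uw : nbhs (pi (f w)) U°.
    apply: open_nbhs_nbhs; split; first exact: open_interior.
    by apply: contrapT => H; apply: nw.
  have /within_continuous_nearP/(_ w Kw _ Uw) := cg.
  by apply: (@filterS _ (nbhs w)) => v Uv [Kv]; apply; exact: Uv.
have nfz : ~ (f @` K') (f z).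
  move=> [w [_ H] fw]; apply: H; by rewrite /preimage /= fw; exact: nU.
have /closed_nearP/(_ _ nfz) := cK'.
apply: filterS => x H [w Kw fw]; apply: contrapT => nUx; apply: H.
exists w => //; split=> // /= /interior_subset; rewrite fw; exact: nUx.
Qed.

(* By Zorn, all but finitely many points of [A] are covered by disjoint
   sequences; each sequence lists [nat * nat], and one of them also absorbs the
   exceptional points. *)
Lemma infinite_surj_prod_nat (T : pointedType) (A : set T) :
  infinite_set A -> exists r : T -> T * nat,
    forall x n, A x -> exists2 y, A y & r y = (x, n).
Proof.
move=> infA.
pose Q (S : set (nat -> T)) := (forall f n, S f -> A (f n)) /\
  forall f g m n, S f -> S g -> f m = g n -> f = g /\ m = n.
have [S [[SA Sinj] Smax]] : exists S, Q S /\ forall B, S `<` B -> ~ Q B.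
  apply: Zorn_bigcup => F FQ Ftot; split.
    by move=> f n [S FS Sf]; have [H _] := FQ _ FS; exact: H.
  move=> f g m n [S FS Sf] [S' FS' S'g].
  have [SS'|S'S] := Ftot _ _ FS FS'.
  - by have [_ H] := FQ _ FS'; apply: H => //; exact: SS'.
  - by have [_ H] := FQ _ FS; apply: H => //; exact: S'S.
pose L := A `\` [set x | exists f n, S f /\ f n = x].
have finL : finite_set L.
  apply: contrapT => /infiniteP/pcard_leP/unsquash h.
  have hL n : L (h n) by exact: funS.
  have hinj : injective h by move=> m n; apply: inj; rewrite inE.
  apply: (Smax (S `|` [set h : nat -> T])).
    split; first by move=> f Sf; left.
    by move=> /(_ h (or_intror erefl)) Sh; have [_] := hL 0; apply; exists h, 0.
  split; first by move=> f n [/SA//|->]; have [] := hL n.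
  move=> f g m n [Sf|->] [Sg|->] e.
  - exact: Sinj.
  - by have [_] := hL n; case; exists f, m.
  - by have [_] := hL m; case; exists g, n.
  - by have /hinj := e.
have [f0 Sf0] : exists f0, S f0.
  apply: contrapT => nS; apply: infA; apply: sub_finite_set finL => x Ax.
  by split=> // -[f [n [Sf _]]]; apply: nS; exists f.
have /countable_injP[h hinj] := finite_set_countable finL.
pose l j := xget point [set x | L x /\ h x = j].
have lh x : L x -> l (h x) = x.
  move=> Lx; rewrite /l; case: xgetP => [y _ [Ly e]|/(_ x)[]//].
  by apply: hinj => //; rewrite inE.
have [dec decK] : exists dec : nat -> nat * nat,
    forall a b, dec (pair_code a b) = (a, b).
  by exists (fun m => odflt (0, 0) (unpickle m)) => a b; rewrite pickleK.
(* The code [k.+1] stands for [f k] itself, and [0] for an exceptional point. *)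
pose G (f : nat -> T) m := if (dec m).1 is k.+1 then (f k, (dec m).2)
  else (l (dec (dec m).2).1, (dec (dec m).2).2).
pose r y := let p := xget (f0, 0) [set p | S p.1 /\ p.1 p.2 = y] in G p.1 p.2.
have rE f m : S f -> r (f m) = G f m.
  move=> Sf; rewrite /r; case: xgetP => [[g n] _ /= [Sg e]|/(_ (f, m))[]//].
  by have [-> ->] := Sinj _ _ _ _ Sg Sf e.
exists r => x n Ax; have [Lx|nLx] := pselect (L x).
  exists (f0 (pair_code 0 (pair_code (h x) n))); first exact: SA.
  by rewrite rE// /G !decK/= lh.
have [f [k [Sf <-]]] : exists f n, S f /\ f n = x.
  by apply: contrapT => H; apply: nLx.
exists (f (pair_code k.+1 n)); first exact: SA.
by rewrite rE// /G !decK.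
Qed.

(** * Dominating families and compact boxes *)

Lemma dominating_infinite (D : set (nat -> nat)) :
  dominating D -> infinite_set D.
Proof.
move=> domD /finite_seqP[s Ds].
have [d Dd [N _ /(_ N (leqnn N)) /=]] := domD (fun n => (\max_(d <- s) d n).+1).
rewrite ltnNge; apply/negP/negPn.
apply: (@leq_bigmax_seq _ s xpredT (fun d => d N) d) => //.
by move: Dd; rewrite Ds.
Qed.

(** The functions [maxn (d n) k], for [d] in [D] and [k] a number, dominate everywhere and not just
    eventually. As [D] is infinite, the pairs [(d, k)] can be indexed by [D] itself, so the
    cardinality does not grow. *)
Lemma dominating_everywhere (D : set (nat -> nat)) : dominating D ->
  exists b : (nat -> nat) -> nat -> nat,
    forall c, exists2 d, D d & forall n, (c n <= b d n)%N.
Proof.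
move=> domD.
have [r rP] := infinite_surj_prod_nat (dominating_infinite domD).
exists (fun d n => maxn ((r d).1 n) (r d).2) => c.
have [d Dd [N _ cd]] := domD c.
(* The constant bounds [c] below [N], where [d] need not. *)
have [d' Dd' rd'] := rP d (\max_(i < N) c i)%N Dd.
exists d' => // n; rewrite rd' leq_max /=; case: (leqP N n) => [Nn|nN].
  by rewrite (cd n Nn).
by rewrite (@leq_bigmax _ (fun i : 'I_N => c i) (Ordinal nN)) orbT.
Qed.

Lemma compact_baire_box (d : nat -> nat) :
  compact [set z : baire_space | forall n, (z n <= d n)%N].
Proof.
apply: (@tychonoff nat (fun=> nat) (fun n => [set k | (k <= d n)%N])) => n.
apply: finite_compact; apply: (sub_finite_set _ (finite_II (d n).+1)).
by move=> k.
Qed.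

Lemma closed_baire_box (d : nat -> nat) :
  closed [set z : baire_space | forall n, (z n <= d n)%N].
Proof.
apply/closed_nearP => z /existsNP[n nz].
apply: filterS (nbhs_cylinder z n.+1) => w zw /(_ n).
by rewrite zw.
Qed.

Lemma dominating_closed_continuity_cover (X Y : topologicalType) (pi : X -> Y)
    C f (D : set (nat -> nat)) :
  hausdorff_space X -> @parametrizes X C f ->
  {within C, continuous (pi \o f)} ->
  dominating D -> closed_continuity_cover pi D.
Proof.
move=> hX [cC cf fX] cg /dominating_everywhere[b bP].
pose K d := C `&` [set z | forall n, (z n <= b d n)%N].
exists (fun d => f @` K d); split.
  have KC d : K d `<=` C by move=> z [].
  have cK d : closed (K d) by apply: closedI => //; exact: closed_baire_box.
  move=> d _.
  apply: closed_continuity_compact_image; [exact: hX|exact: cK| | |].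
  - by apply: (subclosed_compact (cK d) (@compact_baire_box (b d))) => z [].
  - exact: continuous_subspaceW (KC d) cf.
  - exact: continuous_subspaceW (KC d) cg.
rewrite -subTset => x _; have [z Cz <-] := fX x.
by have [d Dd zd] := bP z; exists d => //; exists z.
Qed.

(** * The lower bound *)

(** Membership in the sigma-ideal generated by the closed sets on which [pi] is continuous. *)
Definition sigma_small (X Y : topologicalType) (pi : X -> Y)
    (A : set X) : Prop :=
  exists F : nat -> set X,
    (forall n, closed (F n) /\ {within F n, continuous pi}) /\
    A `<=` \bigcup_n F n.

Lemma sigma_small_bigcup (X Y : topologicalType) (pi : X -> Y)
    (A : nat -> set X) :
  (forall n, sigma_small pi (A n)) -> sigma_small pi (\bigcup_n A n).
Proof.
move=> /choice[F HF].
have F0 : closed (set0 : set X) /\ {within set0, continuous pi}.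
  by split; [exact: closed0|apply/within_continuous_nearP].
exists (fun k => if (unpickle k : option (nat * nat)) is Some p
                 then F p.1 p.2 else set0); split.
  by move=> k; case: unpickle => [[n m]|//]; exact: (HF n).1.
move=> x [n _ Ax]; have [m _ Fx] := (HF n).2 x Ax.
by exists (pair_code n m) => //; rewrite /pair_code pickleK.
Qed.

Lemma sigma_smallS (X Y : topologicalType) (pi : X -> Y) (A B : set X) :
  A `<=` B -> sigma_small pi B -> sigma_small pi A.
Proof. by move=> AB [F [HF BF]]; exists F; split=> // x /AB/BF. Qed.

Lemma sigma_smallU (X Y : topologicalType) (pi : X -> Y) (A B : set X) :
  sigma_small pi A -> sigma_small pi B -> sigma_small pi (A `|` B).
Proof.
move=> sA sB; have sAB n : sigma_small pi (if n is 0 then A else B).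
  by case: n.
by apply: sigma_smallS (sigma_small_bigcup sAB) => x [Ax|Bx];
  [exists 0|exists 1].
Qed.

Lemma sigma_small_closed (X Y : topologicalType) (pi : X -> Y) (F : set X) :
  closed F -> {within F, continuous pi} -> sigma_small pi F.
Proof. by move=> cF pF; exists (fun=> F); split=> // x Fx; exists 0. Qed.

Lemma sigma_small0 (X Y : topologicalType) (pi : X -> Y) : sigma_small pi set0.
Proof.
apply: sigma_small_closed; first exact: closed0.
by apply/within_continuous_nearP.
Qed.

(** The analogue of the perfect kernel of Cantor and Bendixson, with sigma-small images in place of
    countable sets. *)
Definition sigma_kernel (X Y : topologicalType) (pi : X -> Y)
    (C : set baire_space) (f : baire_space -> X) : set baire_space :=
  [set z | C z /\ forall n, ~ sigma_small pi (f @` (C `&` cylinder z n))].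

Section sigma_kernel.
Context (X Y : topologicalType) (pi : X -> Y).
Variables (C : set baire_space) (f : baire_space -> X).
Let K := sigma_kernel pi C f.

Lemma closed_sigma_kernel : closed C -> closed K.
Proof.
move=> cC; apply/closed_nearP => z /not_andP[nCz|/existsNP[n /contrapT sz]].
  have /closed_nearP/(_ z nCz) := cC.
  by apply: filterS => w nCw [].
apply: filterS (nbhs_cylinder z n) => w zw [_ /(_ n)].
by rewrite (cylinder_eq zw).
Qed.

(** There are only countably many cylinders, one for each finite sequence [s], and every point of
    [C] outside the kernel lies in one whose part in [C] has a sigma-small image. *)
Lemma sigma_small_nonkernel : sigma_small pi (f @` (C `\` K)).
Proof.
pose cyl (s : seq nat) : set baire_space := cylinder (nth 0 s) (size s).
pose B k : set X :=
  if (unpickle k : option (seq nat)) is Some s then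
    if pselect (sigma_small pi (f @` (C `&` cyl s))) then f @` (C `&` cyl s)
    else set0
  else set0.
have sB k : sigma_small pi (B k).
  rewrite /B; case: unpickle => [s|]; last exact: sigma_small0.
  by case: pselect => [//|nsB]; exact: sigma_small0.
apply: sigma_smallS (sigma_small_bigcup sB) => _ [z [Cz nKz] <-].
have [n sn] : exists n, sigma_small pi (f @` (C `&` cylinder z n)).
  by apply: contrapT => H; apply: nKz; split=> // n sn; apply: H; exists n.
have zs : cyl (mkseq z n) = cylinder z n.
  rewrite /cyl size_mkseq; apply: cylinder_eq => i ilen.
  by rewrite nth_mkseq.
exists (pickle (mkseq z n)) => //; rewrite /B pickleK zs.
by case: pselect => [sz|//]; exists z.
Qed.

(** Passing from [C] to the kernel loses only a sigma-small image, so a small trace of the kernel on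
    a cylinder would make the trace of [C] small too. *)
Lemma sigma_kernel_cylinder z n : K z ->
  ~ sigma_small pi (f @` (K `&` cylinder z n)).
Proof.
move=> [Cz nz] H; apply: (nz n).
apply: sigma_smallS (sigma_smallU H sigma_small_nonkernel) => _ [w [Cw zw] <-].
have [Kw|nKw] := pselect (K w); first by left; exists w.
by right; exists w.
Qed.

Lemma sigma_kernel_neq0 : parametrizes C f -> ~ sigma_continuous_closed pi ->
  K !=set0.
Proof.
move=> [_ _ fX] npi; apply: contrapT => K0; apply: npi.
have [F [HF CF]] := sigma_small_nonkernel.
exists F; split=> //; rewrite -subTset => x _; apply: CF.
have [z Cz <-] := fX x; exists z => //; split=> // Kz.
by apply: K0; exists z.
Qed.

End sigma_kernel.

(** * The tree of points of discontinuity *)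

Lemma discontinuous_on_closure (R : realType) (X Y : metricType R) (pi : X -> Y)
    (A : set X) :
  ~ {within closure A, continuous pi} ->
  exists y (e : R), (0 < e)%R /\ forall d : R, (0 < d)%R ->
    exists x, [/\ A x, ball y d x & ~ ball (pi y) e (pi x)].
Proof.
move=> npi; apply: contrapT => H; apply: npi.
have {}H (y : X) (e : R) : (0 < e)%R -> exists2 d : R, (0 < d)%R &
    forall x, A x -> ball y d x -> ball (pi y) e (pi x).
  move=> e0; apply: contrapT => Hd; apply: H; exists y, e; split=> // d d0.
  apply: contrapT => Hx; apply: Hd; exists d => // x Ax yx.
  by apply: contrapT => nx; apply: Hx; exists x.
apply/within_continuous_nearP => y _ U /nbhs_ballP[e /= e0 eU].
have e20 : (0 < e / 2)%R by rewrite divr_gt0.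
have [d d0 dA] := H y _ e20.
have d20 : (0 < d / 2)%R by rewrite divr_gt0.
have : nbhs y (ball y (d / 2)) by exact: nbhsx_ballx.
apply: filterS => y' yy' cy'; apply: eU.
have [d' d'0 d'A] := H y' _ e20.
(* A point [x] of [A] close to both [y] and [y'] links [pi y] to [pi y'], so control of [pi] along
   [A] suffices on the whole closure. *)
have [|x [Ax [dx d'x]]] := cy' (ball y' (d / 2) `&` ball y' d').
  by apply: filterI; exact: nbhsx_ballx.
rewrite (splitr e); apply: (@ball_triangle _ _ (pi x)).
  by apply: dA => //; rewrite (splitr d); exact: ball_triangle yy' dx.
by apply: ball_sym; exact: d'A.
Qed.

(** One branching step of the tree. A pair [(z, n)] stands for the trace of the kernel on
    [cylinder z n]; its children [q k] have images converging to [y], while [pi] stays away from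
    [pi y] on them. *)
Lemma sigma_kernel_scheme (R : realType) (X Y : metricType R) (pi : X -> Y)
    C f z n (K := sigma_kernel pi C f) :
  {within C, continuous f} -> {within C, continuous (pi \o f)} -> K z ->
  exists y (e : R) (q : nat -> baire_space * nat), (0 < e)%R /\
    forall k, [/\ K (q k).1, cylinder z n (q k).1, (n < (q k).2)%N &
      forall w, K w -> cylinder (q k).1 (q k).2 w ->
        ball y (k.+1%:R^-1) (f w) /\ ~ ball (pi y) e (pi (f w))].
Proof.
move=> /within_continuous_nearP cf /within_continuous_nearP cg Kz.
have [|y [e [e0 ye]]] := @discontinuous_on_closure R X Y pi
    (f @` (K `&` cylinder z n)).
  move=> cpi; apply: (sigma_kernel_cylinder (n := n) Kz).
  apply: (sigma_smallS _ (sigma_small_closed _ cpi)).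
    exact: subset_closure.
  exact: closed_closure.
(* The other half of [e] pays for the variation of [pi \o f] on the child's cylinder. *)
have e20 : (0 < e / 2)%R by rewrite divr_gt0.
suff /choice[q qP] : forall k : nat, exists q : baire_space * nat,
    [/\ K q.1, cylinder z n q.1, (n < q.2)%N &
      forall w, K w -> cylinder q.1 q.2 w ->
        ball y (k.+1%:R^-1)%R (f w) /\ ~ ball (pi y) (e / 2)%R (pi (f w))].
  by exists y, (e / 2)%R, q.
move=> k; have k0 : (0 < k.+1%:R^-1 :> R)%R by rewrite invr_gt0.
have [_ [[v [Kv zv] <-] yv pyv]] := ye _ k0.
have Cv : C v by case: Kv.
have nyv : nbhs (f v) (ball y k.+1%:R^-1%R).
  by have := metric_ball_open y (k.+1%:R^-1)%R; rewrite openE; apply.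
have npv : nbhs (pi (f v)) (ball (pi (f v)) (e / 2)%R) by exact: nbhsx_ballx.
have /nbhs_baireP[m1 m1P] := cf v Cv _ nyv.
have /nbhs_baireP[m2 m2P] := cg v Cv _ npv.
(* [m1] and [m2] come from the continuity of [f] and [pi \o f] at [v]; [n.+1] makes lengths grow
   strictly, so that branches converge. *)
exists (v, maxn n.+1 (maxn m1 m2)); split=> //=; first by rewrite leq_max ltnSn.
move=> w [Cw _] vw; split.
  by apply: m1P => // i im; apply: vw; rewrite !leq_max im /= orbT.
move=> pyw; apply: pyv; rewrite (splitr e); apply: ball_triangle pyw _.
by apply: ball_sym; apply: m2P => // i im; apply: vw; rewrite !leq_max im !orbT.
Qed.

Lemma closed_continuity_bounded_reduction (R : realType) (X Y : metricType R)
    (pi : X -> Y) C f :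
  @parametrizes X C f -> {within C, continuous (pi \o f)} ->
  ~ sigma_continuous_closed pi ->
  exists psi : (nat -> nat) -> X, forall F : set X,
    closed F -> {within F, continuous pi} ->
    exists d : nat -> nat, forall c, F (psi c) -> forall n, (c n <= d n)%N.
Proof.
move=> Cf cg npi; have [cC cf _] := Cf.
pose K := sigma_kernel pi C f.
have cK : closed K by exact: closed_sigma_kernel.
have [z0 Kz0] : K !=set0 by exact: sigma_kernel_neq0 npi.
have /choice[t tP] : forall p : baire_space * nat,
    exists t : X * R * (nat -> baire_space * nat), K p.1 -> (0 < t.1.2)%R /\
    forall k, [/\ K (t.2 k).1, cylinder p.1 p.2 (t.2 k).1, (p.2 < (t.2 k).2)%N &
      forall w, K w -> cylinder (t.2 k).1 (t.2 k).2 w ->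
        ball t.1.1 (k.+1%:R^-1)%R (f w) /\ ~ ball (pi t.1.1) t.1.2 (pi (f w))].
  move=> [z n]; have [Kz|nKz] := pselect (K z); last first.
    (* A dummy value: by [stK] the branches never leave the kernel. *)
    by exists (f z, 0%R, fun=> (z, n)) => /nKz.
  have [y [e [q H]]] := sigma_kernel_scheme n cf cg Kz.
  by exists (y, e, q) => _.
pose st := fix st (c : nat -> nat) n :=
  if n is m.+1 then (t (st c m)).2 (c m) else (z0, 0).
have stK c n : K (st c n).1.
  elim: n => [//|n IH] /=.
  by have [_ /(_ (c n))[]] := tP _ IH.
have st_lt c n : ((st c n).2 < (st c n.+1).2)%N.
  by have [_ /(_ (c n))[]] := tP _ (stK c n).
have st_ge c n : (n <= (st c n).2)%N.
  by elim: n => // n IH; exact: leq_ltn_trans (st_lt c n).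
have st_le c n k : ((st c n).2 <= (st c (n + k)).2)%N.
  elim: k => [|k IH]; first by rewrite addn0.
  by rewrite addnS (leq_trans IH) // ltnW.
have st_cyl c n k : cylinder (st c n).1 (st c n).2 (st c (n + k)).1.
  elim: k => [|k IH]; first by rewrite addn0.
  have [_ /(_ (c (n + k)))[_ H _ _]] := tP _ (stK c (n + k)).
  rewrite addnS => i ilt; rewrite -(IH i ilt); apply: H.
  exact: leq_trans (st_le c n k).
(* The node at level [i.+1] has length at least [i.+1], so it has already settled coordinate [i]. *)
pose lim c : baire_space := fun i => (st c i.+1).1 i.
have lim_cyl c n : cylinder (st c n).1 (st c n).2 (lim c).
  move=> i ilt; rewrite /lim; case: (leqP n i.+1) => [ni|ni].
    by rewrite -(subnKC ni); exact: st_cyl.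
  rewrite -[in RHS](subnKC (ltnW ni)); apply: esym; apply: st_cyl.
  exact: st_ge.
have limK c : K (lim c).
  apply: contrapT => /(proj1 (closed_nearP K) cK)/nbhs_baireP[n H].
  apply: (H (st c n).1) (stK c n) => i ilt.
  by apply/esym/lim_cyl; exact: leq_trans (st_ge c n).
exists (f \o lim) => F cF /within_continuous_nearP pF.
(* From index [b] on, the children of [p] miss [F]. If [F] contains [y], continuity of [pi] on [F]
   would bring [pi (f w)] too close to [pi y]; otherwise a whole ball around [y] misses [F]. *)
have /choice[b bP] : forall p : baire_space * nat, exists b : nat, K p.1 ->
    forall k w, (b <= k)%N -> K w -> cylinder ((t p).2 k).1 ((t p).2 k).2 w ->
    ~ F (f w).
  move=> p; have [Kp|nKp] := pselect (K p.1); last by exists 0 => /nKp.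
  have [e0 tp] := tP _ Kp; set y := (t p).1.1 in tp.
  have [Fy|nFy] := pselect (F y).
    have /nbhs_ballP[d /= d0 dF] := pF y Fy _ (nbhsx_ballx (pi y) _ e0).
    have [b bd] := natSinv_lt_eventually d0.
    exists b => _ k w bk Kw kw Fw; have [_ _ _ /(_ w Kw kw)[yw]] := tp k; apply.
    by apply: dF => //; apply: le_ball yw; apply: ltW; exact: bd.
  have /closed_nearP/(_ y nFy)/nbhs_ballP[d /= d0 dF] := cF.
  have [b bd] := natSinv_lt_eventually d0.
  exists b => _ k w bk Kw kw; have [_ _ _ /(_ w Kw kw)[yw _]] := tp k.
  by apply: dF; apply: le_ball yw; apply: ltW; exact: bd.
(* The nodes of level [n] whose branches may still meet [F]: there are finitely
   many of them. *)
pose L := fix L n : seq (baire_space * nat) :=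
  if n is m.+1 then
    flatten [seq [seq (t p).2 k | k <- iota 0 (b p)] | p <- L m]
  else [:: (z0, 0)].
exists (fun n => \max_(p <- L n) b p) => c Fc.
(* The limit of the branch lies in child [c n] of [st c n], and its image is in [F]. *)
have c_lt n : (c n < b (st c n))%N.
  rewrite ltnNge; apply/negP => bc.
  exact: (bP _ (stK c n) (c n) (lim c) bc (limK c) (lim_cyl c n.+1)).
have stL n : st c n \in L n.
  elim: n => [|n IH]; first by rewrite inE.
  apply/flattenP; exists [seq (t (st c n)).2 k | k <- iota 0 (b (st c n))].
    by apply/mapP; exists (st c n).
  by apply/mapP; exists (c n) => //; rewrite mem_iota c_lt.
move=> n; apply: leq_trans (ltnW (c_lt n)) _.
exact: (@leq_bigmax_seq _ (L n) xpredT b (st c n)).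
Qed.

(** Each [c] is bounded by the function [d i] attached to a piece [F i] containing [psi c]. So the
    functions [d i] form a dominating family, an image of [L]. *)
Lemma dominating_card_le_cover (X Y : topologicalType) (pi : X -> Y)
    (psi : (nat -> nat) -> X) (T : Type) (L : set T) :
  (forall F : set X, closed F -> {within F, continuous pi} ->
    exists d : nat -> nat, forall c, F (psi c) -> forall n, (c n <= d n)%N) ->
  closed_continuity_cover pi L -> dominating_number #<= L.
Proof.
move=> psiP [F [HF FX]].
have /choice[d dP] : forall i, exists d : nat -> nat, L i ->
    forall c, F i (psi c) -> forall n, (c n <= d n)%N.
  move=> i; have [Li|nLi] := pselect (L i); last by exists (fun=> 0) => /nLi.
  by have [cF pF] := HF _ Li; have [d dP] := psiP _ cF pF; exists d.
apply: card_le_trans (card_image_le d L).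
apply: dominating_numberP.2 => c.
have [i Li Fi] : (\bigcup_(i in L) F i) (psi c) by rewrite FX.
by exists (d i); [exists i|apply: nearW => n; exact: dP].
Qed.

Theorem mainTheorem13 (R : realType) (X Y : metricType R) (pi : X -> Y) :
  analytic_space X ->
  separable_space Y ->
  borel_function pi ->
  ~ sigma_continuous_closed pi ->
  least_cardinal (closed_continuity_cover pi) dominating_number.
Proof.
move=> aX sY bpi npi.
(* An empty [X] is covered by empty sets, contrary to [npi]. *)
have [x0 _] : exists x : X, True.
  apply: contrapT => X0; apply: npi; exists (fun=> set0); split.
    move=> i _; split; first exact: closed0.
    by apply/within_continuous_nearP.
  by rewrite -subTset => x; case: X0; exists x.
have [C [f [Cf cg]]] := borel_parametrizes x0 aX sY bpi.
split.
  apply: (dominating_closed_continuity_cover (@metric_hausdorff _ X) Cf cg).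
  exact: dominating_numberP.1.
have [psi psiP] := closed_continuity_bounded_reduction Cf cg npi.
by move=> T L; exact: dominating_card_le_cover psiP.
Qed.
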